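(* Let $B$ be a ring, $\rho$ an automorphism of $B$, $D$ a $\rho$-derivation of $B$, and $R=B[X;\rho,D]$. Let $f=\sum_{i=0}^m X^i a_i$ ($m\ge 1$, $a_m=1$) be a monic polynomial in $B[X;\rho,D]_{(0)}\cap B^\rho[X]$, and let $A=R/fR$ and $x=X+fR\in A$. Then $f$ is weakly separable in $R$ if and only if \[ A_1\cap \mathrm{Ker}(\tau)=I_x(V). \]
   Context: Rings are associative with identity $1$ (not necessarily commutative), and ring extensions share the same identity. A $\rho$-derivation of $B$ is an additive map $D:B\to B$ with $D(\alpha\beta)=D(\alpha)\rho(\beta)+\alpha D(\beta)$ for all $\alpha,\beta\in B$. $R=B[X;\rho,D]$ is the skew polynomial ring with multiplication determined by $\alpha X=X\rho(\alpha)+D(\alpha)$ for $\alpha\in B$; its elements are written uniquely as $\sum_i X^i c_i$ with coefficients $c_i\in B$ on the right. $B[X;\rho,D]_{(0)}$ is the set of monic polynomials $f\in R$ with $fR=Rf$; for such $f$, $A=R/fR$ is a ring extension of $B$, free with $B$-basis $1,x,\dots,x^{m-1}$. $B^\rho=\{\alpha\in B: \rho(\alpha)=\alpha\}$, and $f\in B^\rho[X]$ means all coefficients $a_i$ lie in $B^\rho$. For a ring extension $A/B$, a $B$-derivation of $A$ (to $A$) is an additive map $\delta:A\to A$ with $\delta(zw)=\delta(z)w+z\delta(w)$ for all $z,w\in A$ and $\delta(B)=\{0\}$; it is inner if there is $m\in A$ with $\delta(z)=mz-zm$ for all $z\in A$. $A/B$ is weakly separable if every $B$-derivation of $A$ to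 $A$ is inner. The polynomial $f$ is weakly separable in $R$ if $A=R/fR$ is weakly separable over $B$. Notation: $I_x:A\to A$, $I_x(z)=zx-xz$. $A_1=\{u\in A: \alpha u=u\rho(\alpha)\ \forall \alpha\in B\}$. $V=\{z\in A:\alpha z=z\alpha\ \forall\alpha\in B\}$. For $0\le j\le m-1$, $y_j=\sum_{k=j}^{m-1}x^{k-j}a_{k+1}\in A$. The map $\tau:A\to A$ is $\tau(z)=\sum_{j=0}^{m-1}y_j z x^j$. *)

(* Defs.v *)
From HB Require Import structures.
From mathcomp Require Import all_boot all_algebra.
From mathcomp Require Import boolp classical_sets.

Set Implicit Arguments.
Unset Strict Implicit.
Unset Printing Implicit Defensive.

Import GRing.Theory.

Local Open Scope classical_set_scope.
Local Open Scope quotient_scope.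
Local Open Scope ring_scope.

Definition skew_derivation (B : nzRingType) (rho : {rmorphism B -> B})
    (D : {additive B -> B}) : Prop :=
  forall a b : B, D (a * b) = D a * rho b + a * D b.

(* The skew polynomial ring B[X; rho, D] with a X = X rho(a) + D(a).  The     *)
(* polynomial p stands for \sum_i X^i p`_i, with coefficients on the RIGHT:   *)
(* the type is a copy of {poly B} that keeps its additive structure and gets  *)
(* a new product.                                                             *)
Definition skewpoly (B : nzRingType) (rho : {rmorphism B -> B})
    (D : {additive B -> B}) of skew_derivation rho D : Type := {poly B}.

Section SkewPolyRing.
Variables (B : nzRingType) (rho : {rmorphism B -> B}) (D : {additive B -> B}).
Variable hD : skew_derivation rho D.

HB.instance Definition _ := GRing.Zmodule.on (skewpoly hD).

(* p |-> p X, since (\sum_i X^i c_i) X = \sum_i (X^(i+1) rho(c_i) + X^i D(c_i)) *)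
Definition skew_mulX (p : {poly B}) : {poly B} :=
  'X * map_poly rho p + map_poly D p.

(* p * q = \sum_j (p X^j) q`_j; in {poly B}, p * c%:P multiplies every        *)
(* coefficient of p by c on the right.                                        *)
Definition skew_mul (p q : {poly B}) : {poly B} :=
  \sum_(j < size q) iter j skew_mulX p * (q`_j)%:P.

Lemma skew_mulX_is_additive : zmod_morphism skew_mulX.
Proof. by move=> p q; rewrite /skew_mulX !raddfB mulrBr addrACA opprD. Qed.

HB.instance Definition _ :=
  GRing.isZmodMorphism.Build {poly B} {poly B} skew_mulX skew_mulX_is_additive.

Lemma iter_skew_mulX_is_additive j : zmod_morphism (iter j skew_mulX).
Proof. by elim: j => [|j IHj] p q //=; rewrite (IHj p q) raddfB. Qed.

HB.instance Definition _ j :=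
  GRing.isZmodMorphism.Build {poly B} {poly B} (iter j skew_mulX)
    (iter_skew_mulX_is_additive j).

Lemma skew_mulXC (p : {poly B}) (c : B) :
  skew_mulX (p * c%:P) = skew_mulX p * (rho c)%:P + p * (D c)%:P.
Proof.
rewrite /skew_mulX rmorphM /= map_polyC /= mulrDl -mulrA -addrA; congr (_ + _).
by apply/polyP => i; rewrite !(coefD, coefMC, coef_map) /= hD.
Qed.

Lemma skew_mul_wide n (p q : {poly B}) : (size q <= n)%N ->
  skew_mul p q = \sum_(j < n) iter j skew_mulX p * (q`_j)%:P.
Proof.
move=> qn; rewrite /skew_mul (big_ord_widen n (fun j => iter j skew_mulX p * (q`_j)%:P)) //.
rewrite big_mkcond /=; apply: eq_bigr => i _; case: ltnP => // /(nth_default 0) ->.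
by rewrite mulr0.
Qed.

Lemma skew_mulBr (p : {poly B}) : zmod_morphism (skew_mul p).
Proof.
move=> q r; pose n := maxn (size q) (size r).
rewrite !(@skew_mul_wide n) ?leq_maxl ?leq_maxr //; last first.
  by rewrite (leq_trans (size_polyD _ _)) // size_polyN.
by rewrite -sumrB; apply: eq_bigr => i _; rewrite coefB polyCB mulrBr.
Qed.

HB.instance Definition _ p :=
  GRing.isZmodMorphism.Build {poly B} {poly B} (skew_mul p) (skew_mulBr p).

Lemma skew_mulDl : left_distributive skew_mul +%R.
Proof.
move=> p q r; rewrite /skew_mul -big_split; apply: eq_bigr => i _ /=.
by rewrite raddfD mulrDl.
Qed.

Lemma skew_mulXnC (p : {poly B}) j (c : B) :
  skew_mul p ('X^j * c%:P) = iter j skew_mulX p * c%:P.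
Proof.
have szc : (size ('X^j * c%:P : {poly B})%R <= j.+1)%N.
  apply/leq_sizeP => i ij; rewrite coefMC coefXn.
  by case: eqP ij => [->|]; rewrite ?ltnn ?mul0r.
rewrite (skew_mul_wide p szc) (bigD1 ord_max) //= big1 => [|i /eqP ij].
  by rewrite addr0 coefMC coefXn eqxx mul1r.
rewrite coefMC coefXn; case: eqP => [e|_]; last by rewrite mul0r mulr0.
by case: ij; apply/val_inj.
Qed.

Lemma polyXnC (p : {poly B}) : p = \sum_(j < size p) 'X^j * (p`_j)%:P.
Proof.
rewrite -{1}[p]coefK poly_def; apply: eq_bigr => i _.
by rewrite -mul_polyC commr_polyXn.
Qed.

Lemma skew_derivation1 : D 1 = 0.
Proof.
have := hD 1 1; rewrite rmorph1 !mulr1 mul1r => /eqP.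
by rewrite -subr_eq subrr eq_sym => /eqP.
Qed.

Lemma skew_mulXXn k : skew_mulX 'X^k = 'X^(k.+1) :> {poly B}.
Proof.
rewrite /skew_mulX map_polyXn -exprS -[RHS]addr0; congr (_ + _); apply/polyP=> i.
rewrite coef_map coef0 coefXn /=.
by case: eqP; rewrite /= ?mulr1n ?mulr0n ?skew_derivation1 ?raddf0.
Qed.

Lemma skew_mul_mulX (p q : {poly B}) :
  skew_mulX (skew_mul p q) = skew_mul p (skew_mulX q).
Proof.
rewrite [q]polyXnC (raddf_sum (skew_mul p)) 2!(raddf_sum skew_mulX) /=.
rewrite (raddf_sum (skew_mul p)) /=; apply: eq_bigr => j _.
by rewrite skew_mulXnC !skew_mulXC skew_mulXXn raddfD /= !skew_mulXnC.
Qed.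

Lemma skew_mulC (p q : {poly B}) c : skew_mul p q * c%:P = skew_mul p (q * c%:P).
Proof.
rewrite [q]polyXnC (raddf_sum (skew_mul p)) !mulr_suml.
rewrite (raddf_sum (skew_mul p)) /=.
by apply: eq_bigr => j _; rewrite -mulrA -polyCM !skew_mulXnC polyCM mulrA.
Qed.

Lemma skew_mulA : associative skew_mul.
Proof.
move=> p q r; rewrite [r]polyXnC (raddf_sum (skew_mul q)) /=.
rewrite (raddf_sum (skew_mul p)) (raddf_sum (skew_mul (skew_mul p q))) /=.
apply: eq_bigr => j _.
rewrite !skew_mulXnC -skew_mulC; congr (_ * _).
by elim: (val j) => //= k IHk; rewrite -skew_mul_mulX IHk.
Qed.

Lemma skew_mul1r : left_id 1 skew_mul.
Proof.
move=> p; rewrite {2}[p]polyXnC; apply: eq_bigr => j _; congr (_ * _).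
by elim: (val j) => //= k ->; rewrite skew_mulXXn.
Qed.

Lemma skew_mulr1 : right_id 1 skew_mul.
Proof. by move=> p; rewrite /skew_mul size_poly1 big_ord1 coef1 mulr1. Qed.

HB.instance Definition _ := GRing.Zmodule_isNzRing.Build (skewpoly hD)
  skew_mulA skew_mul1r skew_mulr1 skew_mulDl
  (fun p q r => raddfD (skew_mul p) q r) (oner_neq0 {poly B}).

Definition skewX : skewpoly hD := 'X.
Definition skewC (a : B) : skewpoly hD := a%:P.
Definition skewcoef (p : skewpoly hD) (i : nat) : B := (p : {poly B})`_i.
Definition skewdeg (p : skewpoly hD) : nat := (size (p : {poly B})).-1.
Definition skewmonic (p : skewpoly hD) : Prop := (p : {poly B}) \is monic.

Lemma skewC_is_zmod_morphism : zmod_morphism skewC.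
Proof. by move=> a b; rewrite /skewC polyCB. Qed.

Lemma skew_mulrC (p : skewpoly hD) (a : B) :
  p * skewC a = (p : {poly B}) * a%:P :> {poly B}.
Proof. by have := skew_mulXnC p 0 a; rewrite expr0 mul1r. Qed.

Lemma skewC_is_monoid_morphism : monoid_morphism skewC.
Proof.
by split=> [|a b]; rewrite /skewC ?polyC1 // -[_ * _ in RHS]/(_ * skewC b)
  skew_mulrC polyCM.
Qed.

HB.instance Definition _ :=
  GRing.isZmodMorphism.Build B (skewpoly hD) skewC skewC_is_zmod_morphism.
HB.instance Definition _ :=
  GRing.isMonoidMorphism.Build B (skewpoly hD) skewC skewC_is_monoid_morphism.

Lemma skew_mulrX (p : skewpoly hD) : p * skewX = skew_mulX p.
Proof. by have := skew_mulXnC p 1 1; rewrite expr1 !mulr1. Qed.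

Lemma skewXnE n : skewX ^+ n = 'X^n :> {poly B}.
Proof. by elim: n => [|n IHn]; rewrite ?expr0 // exprSr skew_mulrX IHn skew_mulXXn. Qed.

Lemma skewC_mulX (a : B) : skewC a * skewX = skewX * skewC (rho a) + skewC (D a).
Proof.
by rewrite skew_mulrX /skew_mulX !map_polyC /= -[skewX * _]/(_ : {poly B}) skew_mulrC.
Qed.

Lemma skewpolyE (p : skewpoly hD) :
  p = \sum_(i < (skewdeg p).+1) skewX ^+ i * skewC (skewcoef p i).
Proof.
rewrite [LHS]polyXnC (big_ord_widen (skewdeg p).+1
  (fun j => 'X^j * ((p : {poly B})`_j)%:P)) ?leqSpred //.
rewrite big_mkcond; apply: eq_bigr => i _ /=; rewrite skew_mulrC skewXnE.
by case: ltnP => // /(nth_default 0); rewrite /skewcoef => ->; rewrite mulr0.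
Qed.

Lemma skewcoef_sum n (c : nat -> B) i :
  skewcoef (\sum_(j < n) skewX ^+ j * skewC (c j)) i = if (i < n)%N then c i else 0.
Proof.
have -> : \sum_(j < n) skewX ^+ j * skewC (c j) = \poly_(j < n) c j.
  rewrite poly_def; apply: eq_bigr => j _.
  by rewrite skew_mulrC skewXnE -mul_polyC commr_polyXn.
exact: coef_poly.
Qed.

End SkewPolyRing.

Arguments skewX {B rho D} hD.
Arguments skewC {B rho D} hD a.

(* f R = R f *)
Definition normal_elt (R : pzRingType) (f : R) : Prop :=
  range (fun r : R => f * r) = range (fun r : R => r * f).

(* f is in B[X; rho, D]_(0) *)
Definition skewpoly0 (B : nzRingType) (rho : {rmorphism B -> B})
    (D : {additive B -> B}) (hD : skew_derivation rho D) : set (skewpoly hD) :=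
  [set f | skewmonic f /\ normal_elt f].

Section NormalQuotient.
Variables (R : pzRingType) (f : R).

Definition rideal : {pred R} := [pred p | `[< range (fun r : R => f * r) p >]].

Lemma ridealP (p : R) : reflect (exists r, p = f * r) (p \in rideal).
Proof.
apply: (iffP (asboolP _)) => [[r _ <-]|[r ->]]; first by exists r.
by exists r.
Qed.

Lemma rideal_zmod_closed : zmod_closed rideal.
Proof.
split; first by apply/ridealP; exists 0; rewrite mulr0.
move=> _ _ /ridealP[r ->] /ridealP[s ->].
by apply/ridealP; exists (r - s); rewrite mulrBr.
Qed.

HB.instance Definition _ := GRing.isZmodClosed.Build R rideal rideal_zmod_closed.

Hypothesis hf : normal_elt f.

Lemma rideal_mulr p r : p \in rideal -> p * r \in rideal.
Proof. by case/ridealP=> s ->; apply/ridealP; exists (s * r); rewrite mulrA. Qed.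

Lemma rideal_mull p r : p \in rideal -> r * p \in rideal.
Proof.
case/ridealP=> s ->; rewrite mulrA; apply: rideal_mulr; apply/asboolP.
by rewrite hf; exists r.
Qed.

(* The ring R / f R; the hypothesis makes f R two-sided. *)
Definition nquot of normal_elt f : Type := {ideal_quot rideal}.

End NormalQuotient.

Section NormalQuotientRing.
Variables (R : pzRingType) (f : R) (hf : normal_elt f).

HB.instance Definition _ := GRing.Zmodule.on (nquot hf).
HB.instance Definition _ := EqQuotient.on (nquot hf).

Definition nquot_pi (p : R) : nquot hf := \pi_(nquot hf) p.

Lemma nquot_eqE (p q : R) : nquot_pi p = nquot_pi q <-> exists r, p - q = f * r.
Proof.
rewrite /nquot_pi; split=> [/eqP|/ridealP pq]; last apply/eqP.
  by rewrite -Quotient.idealrBE => /ridealP.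
by rewrite -Quotient.idealrBE.
Qed.

Lemma nquot_pi_is_zmod_morphism : zmod_morphism nquot_pi.
Proof. by move=> p q; rewrite /nquot_pi raddfB. Qed.

HB.instance Definition _ :=
  GRing.isZmodMorphism.Build R (nquot hf) nquot_pi nquot_pi_is_zmod_morphism.

Lemma nquot_piK (x : nquot hf) : nquot_pi (repr x) = x.
Proof. exact: reprK. Qed.

Definition nquot_mul (x y : nquot hf) : nquot hf := nquot_pi (repr x * repr y).

Lemma nquot_piM p q : nquot_mul (nquot_pi p) (nquot_pi q) = nquot_pi (p * q).
Proof.
apply/nquot_eqE/ridealP; set p' := repr _; set q' := repr _.
have -> : p' * q' - p * q = (p' - p) * q' + p * (q' - q).
  by rewrite mulrBl mulrBr addrA subrK.
by apply: rpredD; [apply: rideal_mulr|apply: (rideal_mull hf)];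
  apply/ridealP/nquot_eqE; rewrite nquot_piK.
Qed.

Lemma nquot_mulA : associative nquot_mul.
Proof.
move=> x y z; rewrite -(nquot_piK x) -(nquot_piK y) -(nquot_piK z).
by rewrite !nquot_piM mulrA.
Qed.

Lemma nquot_mul1l : left_id (nquot_pi 1) nquot_mul.
Proof. by move=> x; rewrite -(nquot_piK x) nquot_piM mul1r. Qed.

Lemma nquot_mul1r : right_id (nquot_pi 1) nquot_mul.
Proof. by move=> x; rewrite -(nquot_piK x) nquot_piM mulr1. Qed.

Lemma nquot_mulDl : left_distributive nquot_mul +%R.
Proof.
move=> x y z; rewrite -(nquot_piK x) -(nquot_piK y) -(nquot_piK z).
by rewrite -raddfD !nquot_piM mulrDl raddfD.
Qed.

Lemma nquot_mulDr : right_distributive nquot_mul +%R.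
Proof.
move=> x y z; rewrite -(nquot_piK x) -(nquot_piK y) -(nquot_piK z).
by rewrite -raddfD !nquot_piM mulrDr raddfD.
Qed.

HB.instance Definition _ := GRing.Zmodule_isPzRing.Build (nquot hf)
  nquot_mulA nquot_mul1l nquot_mul1r nquot_mulDl nquot_mulDr.

Lemma nquot_pi_is_monoid_morphism : monoid_morphism nquot_pi.
Proof. by split=> // p q; rewrite -nquot_piM. Qed.

HB.instance Definition _ :=
  GRing.isMonoidMorphism.Build R (nquot hf) nquot_pi nquot_pi_is_monoid_morphism.

End NormalQuotientRing.

Arguments nquot_pi {R f} hf p.

(* A ring extension A/B is given by its structure map iota : B -> A. *)
Section RingExtension.
Variables (B A : pzRingType) (iota : {rmorphism B -> A}).

Definition ext_derivation (delta : A -> A) : Prop :=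
  [/\ forall z w, delta (z + w) = delta z + delta w,
      forall z w, delta (z * w) = delta z * w + z * delta w
    & forall b, delta (iota b) = 0].

Definition inner_derivation (delta : A -> A) : Prop :=
  exists m : A, forall z, delta z = m * z - z * m.

Definition weakly_separable : Prop :=
  forall delta : A -> A, ext_derivation delta -> inner_derivation delta.

Definition ext_centralizer : set A :=
  [set z | forall b, iota b * z = z * iota b].

Definition ext_twisted (rho : B -> B) : set A :=
  [set u | forall b, iota b * u = u * iota (rho b)].

End RingExtension.

Definition commutator_by (A : pzRingType) (x z : A) : A := z * x - x * z.

Section SkewQuotient.
Variables (B : nzRingType) (rho : {rmorphism B -> B}) (D : {additive B -> B}).
Variables (hD : skew_derivation rho D) (f : skewpoly hD) (hf : normal_elt f).

Definition sqC : B -> nquot hf := nquot_pi hf \o skewC hD.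
HB.instance Definition _ := GRing.RMorphism.on sqC.

Definition sqX : nquot hf := nquot_pi hf (skewX hD).

Definition skewpoly_weakly_separable : Prop := weakly_separable sqC.

Definition sq_y (j : nat) : nquot hf :=
  \sum_(j <= k < skewdeg f) sqX ^+ (k - j) * sqC (skewcoef f k.+1).

Definition sq_tau (z : nquot hf) : nquot hf :=
  \sum_(j < skewdeg f) sq_y j * z * sqX ^+ j.

End SkewQuotient.

Arguments sq_tau {B rho D hD f} hf z.

(* Main.v *)
Require Import Defs.
From HB Require Import structures.
From mathcomp Require Import all_boot all_algebra.
From mathcomp Require Import boolp classical_sets.

Set Implicit Arguments.
Unset Strict Implicit.
Unset Printing Implicit Defensive.

Import GRing.Theory.

Local Open Scope classical_set_scope.
Local Open Scope ring_scope.

(** A [B]-derivation [delta] of [A = R/fR] is determined by [u = delta x], so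
    the question is which [u] occur.  Applying [delta] to
    [alpha x = x rho(alpha) + D(alpha)] gives [alpha u = u rho(alpha)], that is,
    [u] is in [A_1]; applying it to [f(x) = 0] gives
    [\sum_i (\sum_(j < i) x^(i-1-j) u x^j) a_i = 0].  These two conditions are
    also sufficient: [u] in [A_1] is what is needed to extend [X |-> u] to a
    [B]-derivation from [R] to [A] ([ext_derivation_exists]), and the second condition
    makes it vanish on [f], hence on the two-sided ideal [fR].

    The second condition is [tau u = 0] ([sq_tau_leibniz]).  Indeed the terms of
    [tau u] are the [x^(i-1-j) a_i u x^j], and [a_i] moves to the far right: it
    commutes with [u] because [u] is in [A_1] and [rho] fixes [a_i], and with
    [x] because [D a_i = 0] ([normal_coef_derivation0]).  The latter holds since
    [f X - X f = \sum_i X^i D(a_i)] lies in [fR] and has degree less than that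
    of the monic [f].

    So [delta |-> delta x] is a bijection from the [B]-derivations of [A] onto
    the intersection of [A_1] with the kernel of [tau]
    ([ext_derivation_at_sqXP], [ext_derivation_eq]).  The derivation
    [z |-> m z - z m] kills [B] exactly when [m] is in [V], and its value at [x]
    is [I_x m]; hence the inner ones correspond to [I_x(V)], and every
    derivation is inner if and only if the two sets agree. *)

(** * Degrees and coefficients of skew polynomials *)

Section SkewPolyDegree.
Variables (B : nzRingType) (rho : {rmorphism B -> B}) (D : {additive B -> B}).
Variable hD : skew_derivation rho D.

(** As [rho 1 = 1], right multiplication by [X] raises the degree of a monic
    polynomial by one and keeps it monic. *)
Lemma iter_skew_mulX_top n (p : {poly B}) j :
    (forall i, (n < i)%N -> p`_i = 0) -> p`_n = 1 ->
  (forall i, (n + j < i)%N -> (iter j (skew_mulX rho D) p)`_i = 0) /\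
  (iter j (skew_mulX rho D) p)`_(n + j) = 1.
Proof.
move=> pgt pn; elim: j => [|j [IHgt IHn]]; first by rewrite addn0.
rewrite iterS addnS; split=> [[|i] // ltni|];
  rewrite /skew_mulX coefD coefXM !coef_map /=.
  by rewrite !IHgt // ?rmorph0 ?raddf0 ?addr0 // ltnW.
by rewrite IHn rmorph1 IHgt // raddf0 addr0.
Qed.

Lemma skewmonic_coef (f : skewpoly hD) : skewmonic f -> skewcoef f (skewdeg f) = 1.
Proof. by move/eqP. Qed.

Lemma skewcoef_gt_deg (f : skewpoly hD) i :
  (skewdeg f < i)%N -> skewcoef f i = 0.
Proof. by move=> lti; apply: nth_default; apply: leq_trans lti; apply: leqSpred. Qed.

(** Since [f] is monic, [f * r] has at degree [skewdeg f + skewdeg r] the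
    leading coefficient of [r], even when [B] has zero divisors. *)
Lemma skewmonic_mul_small (f r : skewpoly hD) : skewmonic f ->
  (forall i, (skewdeg f <= i)%N -> skewcoef (f * r) i = 0) -> r = 0.
Proof.
move=> monf small; apply/eqP; rewrite -lead_coef_eq0; apply/eqP.
have [r0|rn0] := eqVneq (r : {poly B}) 0; first by rewrite r0 lead_coef0.
have top j := iter_skew_mulX_top j (@skewcoef_gt_deg f) (skewmonic_coef monf).
have := small (skewdeg f + skewdeg r)%N (leq_addr _ _).
rewrite /skewcoef -[f * r]/(skew_mul rho D f r) /skew_mul /skewdeg.
move: rn0; rewrite -size_poly_gt0; case szr: (size _) => [//|n] _ /=.
rewrite coef_sum big_ord_recr /= coefMC big1 => [|i _].
  by have [_ ->] := top n; rewrite add0r mul1r lead_coefE szr.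
by have [gt0 _] := top i; rewrite coefMC gt0 ?mul0r // ltn_add2l.
Qed.

Lemma skew_mulXr (p : skewpoly hD) : skewX hD * p = 'X * (p : {poly B}) :> {poly B}.
Proof.
rewrite -[LHS]/(skew_mul rho D 'X p) /skew_mul [p in RHS]polyXnC mulr_sumr.
apply: eq_bigr => j _; rewrite mulrA -exprS; congr (_ * _).
by elim: (val j) => [|k IHk] /=; rewrite ?expr1 // IHk (skew_mulXXn hD).
Qed.

(** [f X - X f = \sum_i X^i D(a_i)] has degree less than [skewdeg f] because
    [D 1 = 0], yet it is a right multiple of [f] by normality; hence it is 0. *)
Lemma normal_coef_derivation0 (f : skewpoly hD) : skewmonic f -> normal_elt f ->
  (forall i, rho (skewcoef f i) = skewcoef f i) ->
  forall i, D (skewcoef f i) = 0.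
Proof.
move=> monf hf rhof.
have [r _ fr] : range (fun r : skewpoly hD => f * r) (skewX hD * f).
  by rewrite hf; exists (skewX hD).
have fXr : f * (skewX hD - r) = map_poly D (f : {poly B}).
  rewrite mulrBr fr skew_mulrX skew_mulXr /skew_mulX.
  have -> : map_poly rho (f : {poly B}) = f.
    by apply/polyP => i; rewrite coef_map; apply: rhof.
  by rewrite -[_ - _]/(_ - _ : {poly B}) addrC addKr.
have Xr0 : skewX hD - r = 0.
  apply: (skewmonic_mul_small monf) => i; rewrite fXr /skewcoef coef_map /=.
  rewrite leq_eqVlt => /predU1P[<-|/skewcoef_gt_deg fi0].
    by rewrite -[_`__]/(skewcoef f _) skewmonic_coef // (skew_derivation1 hD).
  by rewrite -[_`__]/(skewcoef f _) fi0 raddf0.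
move=> i; rewrite -[LHS](coef_map D f i) -fXr Xr0 mulr0; exact: coef0.
Qed.

End SkewPolyDegree.

(** * Derivations on skew polynomials *)

(** The value at [x ^+ i] of a derivation that maps [x] to [u]. *)
Definition leibniz_pow (A : pzRingType) (x u : A) (i : nat) : A :=
  \sum_(j < i) x ^+ (i.-1 - j) * u * x ^+ j.

Lemma leibniz_powS (A : pzRingType) (x u : A) i :
  leibniz_pow x u i.+1 = leibniz_pow x u i * x + x ^+ i * u.
Proof.
rewrite /leibniz_pow big_ord_recl /= subn0 expr0 mulr1 addrC; congr (_ + _).
rewrite mulr_suml; apply: eq_bigr => j _.
by rewrite -[RHS]mulrA -exprSr -[i.-1]subn1 -subnDA add1n.
Qed.

Lemma derivation_expr (A : pzRingType) (delta : A -> A) (x : A) i :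
    (forall z w, delta (z * w) = delta z * w + z * delta w) ->
  delta (x ^+ i) = leibniz_pow x (delta x) i.
Proof.
move=> dM; elim: i => [|i IHi]; last by rewrite exprSr dM IHi leibniz_powS.
rewrite /leibniz_pow big_ord0 expr0; apply: (@addrI _ (delta 1)).
by rewrite addr0 -{3}[1]mulr1 dM mulr1 mul1r.
Qed.

Section SkewDerivations.
Variables (B : nzRingType) (rho : {rmorphism B -> B}) (D : {additive B -> B}).
Variables (hD : skew_derivation rho D) (A : pzRingType).
Variable phi : {rmorphism skewpoly hD -> A}.

Local Notation x := (phi (skewX hD)).
Local Notation C b := (phi (skewC hD b)).

(** The only candidate for a derivation along [phi] that kills [B] and maps
    [X] to [u]; summing over the coefficients makes it well defined for every
    [u], before the Leibniz rule is known. *)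
Definition leibniz (u : A) (p : skewpoly hD) : A :=
  \sum_(i < (skewdeg p).+1) leibniz_pow x u i * C (skewcoef p i).

Lemma leibniz_wide u n (p : skewpoly hD) : (skewdeg p < n)%N ->
  leibniz u p = \sum_(i < n) leibniz_pow x u i * C (skewcoef p i).
Proof.
move=> ltpn; rewrite /leibniz.
rewrite (big_ord_widen n (fun i => leibniz_pow x u i * C (skewcoef p i))) //.
rewrite big_mkcond; apply: eq_bigr => i _ /=; case: ltnP => // /skewcoef_gt_deg ->.
by rewrite !rmorph0 mulr0.
Qed.

Lemma leibnizB u : zmod_morphism (leibniz u).
Proof.
move=> p q; pose n := (maxn (skewdeg p) (maxn (skewdeg q) (skewdeg (p - q)))).+1.
rewrite !(@leibniz_wide u n) ?ltnS ?leq_max ?leqnn ?orbT //.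
rewrite -sumrB; apply: eq_bigr => i _.
have -> : skewcoef (p - q) i = skewcoef p i - skewcoef q i by apply: coefB.
by rewrite !rmorphB mulrBr.
Qed.

HB.instance Definition _ u :=
  GRing.isZmodMorphism.Build (skewpoly hD) A (leibniz u) (leibnizB u).

Lemma leibniz_monomial u i c :
  leibniz u (skewX hD ^+ i * skewC hD c) = leibniz_pow x u i * C c.
Proof.
set p := _ * _; pose n := maxn (skewdeg p) i.
have pE k : skewcoef p k = if k == i then c else 0.
  rewrite /skewcoef /p skew_mulrC skewXnE coefMC coefXn.
  by case: eqP; rewrite ?mul1r ?mul0r.
have lti : (i < n.+1)%N by rewrite ltnS leq_maxr.
rewrite (@leibniz_wide u n.+1) ?ltnS ?leq_maxl // (bigD1 (Ordinal lti)) //=.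
rewrite pE eqxx big1 ?addr0 // => k /negPf; rewrite -val_eqE pE /= => ->.
by rewrite !rmorph0 mulr0.
Qed.

Lemma leibnizMC u p c : leibniz u (p * skewC hD c) = leibniz u p * C c.
Proof.
rewrite [p]skewpolyE mulr_suml !raddf_sum mulr_suml; apply: eq_bigr => i _ /=.
by rewrite -mulrA -rmorphM !leibniz_monomial rmorphM /= rmorphM mulrA.
Qed.

Section Twisted.
Variable u : A.
Hypothesis twu : forall b, C b * u = u * C (rho b).

(** The twisted commutation of [u] with [B] is exactly what makes the Leibniz
    rule compatible with [c X = X rho(c) + D(c)]: on [X^i c] the two sides
    differ by [x^i (u rho(c) - c u)]. *)
Lemma leibnizMX p :
  leibniz u (p * skewX hD) = leibniz u p * x + phi p * u.
Proof.
rewrite [p]skewpolyE mulr_suml !raddf_sum !mulr_suml -big_split.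
apply: eq_bigr => i _ /=; set c := skewcoef p i.
rewrite -mulrA skewC_mulX mulrDr mulrA -exprSr raddfD /= !leibniz_monomial.
rewrite leibniz_powS rmorphM rmorphXn /= -!mulrA twu -[C c * x]rmorphM.
by rewrite skewC_mulX rmorphD rmorphM /= mulrDl mulrDr -!mulrA addrAC.
Qed.

Lemma leibnizMXn p i :
  leibniz u (p * skewX hD ^+ i) =
  leibniz u p * x ^+ i + phi p * leibniz_pow x u i.
Proof.
elim: i => [|i IHi].
  by rewrite /leibniz_pow big_ord0 !expr0 !mulr1 mulr0 addr0.
rewrite exprSr mulrA leibnizMX IHi leibniz_powS rmorphM rmorphXn /= exprSr.
by rewrite mulrDl mulrDr !mulrA addrA.
Qed.

(** Enough to check it for [q = X^i c], where it follows by multiplying by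
    [X] repeatedly and then by [c]. *)
Lemma leibnizM p q : leibniz u (p * q) = leibniz u p * phi q + phi p * leibniz u q.
Proof.
rewrite [q]skewpolyE mulr_sumr !raddf_sum !mulr_sumr -big_split.
apply: eq_bigr => i _ /=.
rewrite mulrA leibnizMC leibnizMXn leibniz_monomial rmorphM rmorphXn /=.
by rewrite mulrDl !mulrA.
Qed.

End Twisted.
End SkewDerivations.

(** * Derivations of the quotient *)

Section QuotientDerivations.
Variables (B : nzRingType) (rho : {rmorphism B -> B}) (D : {additive B -> B}).
Variables (hD : skew_derivation rho D) (f : skewpoly hD) (hf : normal_elt f).

Local Notation A := (nquot hf).
Local Notation x := (sqX hf).
Local Notation C := (sqC hf).
Local Notation pi := (nquot_pi hf).

Lemma sqC_mulX b : C b * x = x * C (rho b) + C (D b).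
Proof. by rewrite -(rmorphM pi) skewC_mulX rmorphD rmorphM. Qed.

Lemma nquot_pi_skewpoly p :
  pi p = \sum_(i < (skewdeg p).+1) x ^+ i * C (skewcoef p i).
Proof.
rewrite {1}[p]skewpolyE raddf_sum; apply: eq_bigr => i _ /=.
by rewrite rmorphM rmorphXn.
Qed.

Lemma nquot_pi_gen : pi f = 0.
Proof. by rewrite -(rmorph0 pi); apply/nquot_eqE; exists 1; rewrite subr0 mulr1. Qed.

Lemma ext_derivation0 (delta : A -> A) : ext_derivation C delta -> delta 0 = 0.
Proof. by case=> _ _ dC; have := dC 0; rewrite rmorph0. Qed.

Lemma ext_derivation_pi (delta : A -> A) p :
  ext_derivation C delta -> delta (pi p) = leibniz pi (delta x) p.
Proof.
move=> hd; have d0 := ext_derivation0 hd; case: hd => dD dM dC.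
rewrite nquot_pi_skewpoly (big_morph delta dD d0); apply: eq_bigr => i _.
by rewrite dM dC mulr0 addr0 derivation_expr.
Qed.

Lemma ext_derivation_eq (d1 d2 : A -> A) :
    ext_derivation C d1 -> ext_derivation C d2 -> d1 x = d2 x ->
  forall z, d1 z = d2 z.
Proof.
move=> hd1 hd2 e z.
by rewrite -(nquot_piK z) (ext_derivation_pi _ hd1) (ext_derivation_pi _ hd2) e.
Qed.

Lemma ext_derivation_twisted (delta : A -> A) :
  ext_derivation C delta -> ext_twisted C rho (delta x).
Proof.
case=> dD dM dC b; have := congr1 delta (sqC_mulX b).
by rewrite dD !dM !dC !mulr0 mul0r add0r !addr0.
Qed.

(** A derivation along [pi] that vanishes at [f] vanishes on [fR], so it
    descends to the quotient. *)
Lemma ext_derivation_exists u : ext_twisted C rho u -> leibniz pi u f = 0 ->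
  exists2 delta : A -> A, ext_derivation C delta & delta x = u.
Proof.
move=> twu lf0; pose delta (z : A) := leibniz pi u (repr z).
have deltaE p : delta (pi p) = leibniz pi u p.
  apply/eqP; rewrite -subr_eq0 -raddfB /=.
  have [r ->] : exists r, repr (pi p) - p = f * r.
    by apply/(nquot_eqE hf); rewrite nquot_piK.
  by rewrite (leibnizM twu) /= lf0 nquot_pi_gen !mul0r addr0.
exists delta; first split=> [z w|z w|b].
- by rewrite -(nquot_piK z) -(nquot_piK w) -raddfD !deltaE raddfD.
- by rewrite -(nquot_piK z) -(nquot_piK w) -rmorphM !deltaE (leibnizM twu).
- rewrite deltaE -[skewC hD b]mul1r -(expr0 (skewX hD)) leibniz_monomial.
  by rewrite /leibniz_pow big_ord0 mul0r.
rewrite deltaE -[skewX hD]mulr1 -(rmorph1 (skewC hD)) -[skewX hD in LHS]expr1.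
rewrite leibniz_monomial leibniz_powS /leibniz_pow big_ord0 mul0r add0r expr0.
by rewrite mul1r !rmorph1 mulr1.
Qed.

Lemma sqX_exp_coef_comm b i : rho b = b -> D b = 0 -> C b * x ^+ i = x ^+ i * C b.
Proof.
move=> rb Db; apply: commrX.
by rewrite /GRing.comm sqC_mulX rb Db rmorph0 addr0.
Qed.

Section InvariantCoefficients.
Hypotheses (monf : skewmonic f).
Hypothesis rhof : forall i, rho (skewcoef f i) = skewcoef f i.

(** Both sides are sums over [j < i <= skewdeg f], of [x^(i-1-j) a_i u x^j] and
    [x^(i-1-j) u x^j a_i]; each [a_i] commutes with [u], being fixed by [rho],
    and with [x], since also [D a_i = 0]. *)
Lemma sq_tau_leibniz u : ext_twisted C rho u -> sq_tau hf u = leibniz pi u f.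
Proof.
move=> twu; have Df := normal_coef_derivation0 monf hf rhof.
rewrite /leibniz big_ord_recl /leibniz_pow big_ord0 mul0r add0r /sq_tau /sq_y.
under eq_bigr do rewrite !mulr_suml.
under [RHS]eq_bigr do rewrite mulr_suml.
under eq_bigr => j _ do rewrite (big_nat_widenl _ 0) // big_mkord.
rewrite (exchange_big_dep xpredT) //; apply: eq_bigr => k _ /=.
rewrite (big_ord_widen (skewdeg f) (fun j => x ^+ (k.+1.-1 - j) * u * x ^+ j *
  C (skewcoef f k.+1))) //; apply: eq_bigr => j _ /=.
rewrite -!mulrA -(sqX_exp_coef_comm _ (rhof _) (Df _)).
by rewrite (mulrA (C _) u) twu rhof !mulrA.
Qed.

(** Given that [u] is in [A_1], the equation [tau u = 0] says that the candidate
    derivation on [R] vanishes at [f], which is what it takes to descend to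
    [A]. *)
Lemma ext_derivation_at_sqXP u :
  (ext_twisted C rho `&` [set z | sq_tau hf z = 0]) u <->
  exists2 delta : A -> A, ext_derivation C delta & delta x = u.
Proof.
split=> [[twu /= tau0]|[delta hd <-]].
  by apply: ext_derivation_exists; rewrite // -sq_tau_leibniz.
have twu := ext_derivation_twisted hd; split=> //=.
by rewrite sq_tau_leibniz // -ext_derivation_pi // nquot_pi_gen ext_derivation0.
Qed.

End InvariantCoefficients.
End QuotientDerivations.

(** * Weak separability *)

Lemma inner_ext_derivation (B A : pzRingType) (iota : {rmorphism B -> A}) (m : A) :
  ext_centralizer iota m -> ext_derivation iota (fun z => m * z - z * m).
Proof.
move=> cm; split=> [z w|z w|b]; last by rewrite cm subrr.
  by rewrite mulrDr mulrDl opprD addrACA.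
by rewrite mulrBl mulrBr !mulrA addrA subrK.
Qed.

Theorem theorem3p8 (B : nzRingType) (rho : {rmorphism B -> B})
    (D : {additive B -> B}) (hD : skew_derivation rho D)
    (f : skewpoly hD) (hf : skewpoly0 f) :
  bijective rho ->
  (0 < skewdeg f)%N ->
  (forall i, rho (skewcoef f i) = skewcoef f i) ->
  skewpoly_weakly_separable (proj2 hf) <->
  ext_twisted (sqC (proj2 hf)) rho `&` [set z | sq_tau (proj2 hf) z = 0] =
    commutator_by (sqX (proj2 hf)) @` ext_centralizer (sqC (proj2 hf)).
Proof.
move=> _ _ rhof; case: hf => monf nf /=.
have derP := @ext_derivation_at_sqXP _ _ _ _ _ nf monf rhof.
split=> [ws|eqA delta hd].
  apply/seteqP; split=> [u /derP[delta hd <-]|_ [v cv <-]]; last first.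
    by apply/derP; eexists; first exact: (inner_ext_derivation cv).
  have [m dm] := ws delta hd; exists m; last by rewrite dm.
  by move=> b; apply/esym/eqP; rewrite -subr_eq0 -dm; case: hd => _ _ ->.
have : (ext_twisted (sqC nf) rho `&` [set z | sq_tau nf z = 0]) (delta (sqX nf)).
  by apply/derP; exists delta.
rewrite eqA => -[v cv vE]; exists v => z.
exact: (ext_derivation_eq hd (inner_ext_derivation cv)).
Qed.
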